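(* Fix an integer $\overline{m}\geq 1$, put $m=2\overline{m}$, and let $G_3=(\{1,2,3\},A,1,2)$ be the doubly-rooted digraph with roots $s=1$, $t=2$ and edges $a_1,\dots,a_{m+7}$, where (writing $a_x=(i,j)$ for $a_x^-=i$, $a_x^+=j$) $a_{2\ell-1}=(1,2)$, $a_{2\ell}=(2,1)$ for $\ell=1,\dots,\overline{m}$, $a_{m+1}=(1,1)$, $a_{m+2}=(1,2)$, $a_{m+3}=(2,3)$, $a_{m+4}=(3,1)$, $a_{m+5}=(1,3)$, $a_{m+6}=(3,2)$, $a_{m+7}=(3,3)$. Let $B=\{a_1,\dots,a_m\}$. Then, with respect to the enumeration $(a_1,\dots,a_{m+7})$, $S(G_3,B)=\tfrac{2}{3}\,\overline{m}\,(\overline{m}+2)!\,\overline{m}!$.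
   Context: For a doubly-rooted digraph $G=(V,A,s,t)$ (each edge $a$ has source $a^-$, target $a^+$; loops and multiple edges allowed) with enumeration $A=\{a_1,\dots,a_k\}$ and $B\subseteq A$: $M(B)=\{j\in[k]:a_j\in B\}$; $P(G)=\{\sigma\in\mathfrak{S}_k: a_{\sigma(1)}^-=s,\ a_{\sigma(k)}^+=t,\ a_{\sigma(j+1)}^-=a_{\sigma(j)}^+\ \forall j\in[k-1]\}$; for $M=\{j_1<\dots<j_\ell\}\subseteq[k]$, $\sigma_M\in\mathfrak{S}_\ell$ is $\sigma_M(g)=|\{h\in[\ell]:\sigma(j_h)\le\sigma(j_g)\}|$; $S(G,B)=\sum_{\sigma\in P(G)}\mathrm{sgn}(\sigma)\mathrm{sgn}(\sigma_{M(B)})$. *)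

(* Defs.v *)
From mathcomp Require Import all_boot all_order all_algebra all_fingroup.
Set Implicit Arguments. Unset Strict Implicit. Unset Printing Implicit Defensive.
Import GRing.Theory Num.Theory.
Local Open Scope ring_scope.

(* A doubly-rooted digraph with k enumerated edges a_0,...,a_{k-1} (0-based
   indices for the paper's a_1,...,a_k): src j = a_j^-, tgt j = a_j^+. *)
Record drgraph (V : finType) (k : nat) := DRGraph {
  src : 'I_k -> V;
  tgt : 'I_k -> V;
  sroot : V;
  troot : V }.

(* P(G): permutations sigma (position -> edge) forming an Eulerian trail
   from s to t. Positions are 0-based. *)
Definition Ptrail (V : finType) (k : nat) (G : drgraph V k) (sigma : 'S_k) : bool :=
  [forall p : 'I_k, (val p == 0%N) ==> (src G (sigma p) == sroot G)] &&
  [forall p : 'I_k, (val p == k.-1) ==> (tgt G (sigma p) == troot G)] &&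
  [forall p : 'I_k, forall q : 'I_k,
     (val q == (val p).+1) ==> (src G (sigma q) == tgt G (sigma p))].

Definition perm_of_fun (n : nat) (f : 'I_n -> 'I_n) : 'S_n :=
  match injectiveP f with
  | ReflectT H => perm H
  | ReflectF _ => 1%g
  end.

(* sigma_M, for M = {j_1 < ... < j_l}: the relative order on M of the values
   tau(j) (0-based rank).  enum_val of a set of ordinals lists it increasingly. *)
Definition restr_rank (k : nat) (tau : 'S_k) (M : {set 'I_k}) : 'S_#|M| :=
  perm_of_fun (fun g : 'I_#|M| =>
    insubd g (#|[set h : 'I_#|M| | (val (tau (enum_val h)) <= val (tau (enum_val g)))%N]|.-1)).

Definition sgnp (k : nat) (s : 'S_k) : int := (-1) ^+ odd_perm s.

(* S(G,B) = sum_{sigma in P(G)} sgn(sigma) sgn(sigma_{M(B)}).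
   READING: sigma_M is computed from sigma^{-1}
   (edge -> position), i.e. from the positions of the edges of B in the trail. *)
Definition Ssum (V : finType) (k : nat) (G : drgraph V k) (B : {set 'I_k}) : int :=
  \sum_(sigma : 'S_k | Ptrail G sigma) sgnp sigma * sgnp (restr_rank (sigma^-1)%g B).

(* The graph G_3 for mbar, with m = 2 mbar, vertices 1,2,3 as 'I_3 = {0,1,2},
   k = m + 7 edges. Edge index x (0-based) is the paper's a_{x+1}. *)
Definition V1 : 'I_3 := inord 0.
Definition V2 : 'I_3 := inord 1.
Definition V3 : 'I_3 := inord 2.

Definition G3_src (mb : nat) (x : 'I_(2 * mb + 7)) : 'I_3 :=
  let m := (2 * mb)%N in
  if (val x < m)%N then (if odd (val x) then V2 else V1)
  else match (val x - m)%N with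
       | 0 => V1 | 1 => V1 | 2 => V2 | 3 => V3 | 4 => V1 | 5 => V3 | _ => V3 end.

Definition G3_tgt (mb : nat) (x : 'I_(2 * mb + 7)) : 'I_3 :=
  let m := (2 * mb)%N in
  if (val x < m)%N then (if odd (val x) then V1 else V2)
  else match (val x - m)%N with
       | 0 => V1 | 1 => V2 | 2 => V3 | 3 => V1 | 4 => V3 | 5 => V2 | _ => V3 end.

Definition G3 (mb : nat) : drgraph 'I_3 (2 * mb + 7) :=
  DRGraph (G3_src (mb:=mb)) (G3_tgt (mb:=mb)) V1 V2.

Definition B3 (mb : nat) : {set 'I_(2 * mb + 7)} :=
  [set x : 'I_(2 * mb + 7) | (val x < 2 * mb)%N].

(* Main.v *)
Require Import Defs.
From mathcomp Require Import all_boot all_order all_algebra all_fingroup.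
From mathcomp Require Import zify ring.
Set Implicit Arguments. Unset Strict Implicit. Unset Printing Implicit Defensive.
Import GRing.Theory Num.Theory.
Local Open Scope ring_scope.

(* Read a trail as sigma : position -> edge.  The inversions of sigma^-1 lying inside B
   are those of sigma_{M(B)}, so sgn(sigma) sgn(sigma_{M(B)}) = (-1)^N, where N counts the
   inversions of sigma^-1 not inside B.  Expanding along the first edge of the trail turns
   S(G,B) into a signed count of trails through a list of edges, in which passing over an
   earlier edge costs a sign unless both edges are in B.
   In G_3 the edges of B are mbar copies of 1 -> 2 and mbar copies of 2 -> 1, listed before
   the seven other edges; they are interchangeable and never produce a sign, so the count
   depends only on how many of each are left and on the list S of remaining other edges.
   Degree balance forces these numbers to be n + alpha and n + beta, and the count is
   (n + alpha)! (n + beta)! P_{S,v}(n) for a polynomial P_{S,v} obtained by solving the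
   recursion in n in the binomial basis.  For the seven other edges of G_3,
   P(n) = 2/3 n (n+1) (n+2). *)

Section LiftPermSum.

Variables (n : nat) (i : 'I_n.+1).

Definition unlift_perm_fun (s : 'S_n.+1) (k : 'I_n) : 'I_n :=
  odflt k (unlift (s i) (s (lift i k))).

Lemma lift_unlift_perm_fun (s : 'S_n.+1) k :
  lift (s i) (unlift_perm_fun s k) = s (lift i k).
Proof.
rewrite /unlift_perm_fun; have := neq_lift i k.
by rewrite -(can_eq (permK s)) => /unlift_some[] ? ? ->.
Qed.

Lemma unlift_perm_fun_inj (s : 'S_n.+1) : injective (unlift_perm_fun s).
Proof.
move=> k1 k2 /(congr1 (lift (s i))).
by rewrite !lift_unlift_perm_fun => /perm_inj /lift_inj.
Qed.

Definition unlift_perm (s : 'S_n.+1) : 'S_n := perm (@unlift_perm_fun_inj s).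

Lemma lift_unlift_perm (s : 'S_n.+1) : lift_perm i (s i) (unlift_perm s) = s.
Proof.
apply/permP => k; case: (unliftP i k) => [k'|] ->; last by rewrite lift_perm_id.
by rewrite lift_perm_lift permE lift_unlift_perm_fun.
Qed.

Lemma unlift_permK j : cancel (lift_perm i j) unlift_perm.
Proof.
move=> t; apply/permP => k; apply: (@lift_inj _ j).
by rewrite permE -{1}(lift_perm_id i j t) lift_unlift_perm_fun lift_perm_lift.
Qed.

Lemma sum_lift_perm (R : nmodType) (F : 'S_n.+1 -> R) j :
  \sum_(s : 'S_n.+1 | s i == j) F s = \sum_(t : 'S_n) F (lift_perm i j t).
Proof.
rewrite (reindex (lift_perm i j)); last first.
  exists unlift_perm => [t _ | s /eqP <-]; first exact: unlift_permK.
  exact: lift_unlift_perm.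
by apply: eq_bigl => t; rewrite lift_perm_id eqxx.
Qed.

End LiftPermSum.

Definition invn n (s : 'S_n) : nat :=
  \sum_(x < n) \sum_(y < n) ((x < y) && (s y < s x))%N.

Lemma bump_ltn j x y : (bump j x < bump j y)%N = (x < y)%N.
Proof. by rewrite /bump; case: (leqP j x); case: (leqP j y) => /=; lia. Qed.

Lemma bump_ltn_self j x : (bump j x < j)%N = (x < j)%N.
Proof. by rewrite /bump; case: (leqP j x) => /=; lia. Qed.

Lemma sum_ltn_ord n j : (\sum_(y < n) (y < j))%N = minn j n.
Proof.
elim: n => [|n IH]; first by rewrite big_ord0; lia.
by rewrite big_ord_recr /= IH; case: (ltnP n j) => /=; lia.
Qed.

Lemma invn_lift0 n (j : 'I_n.+1) (t : 'S_n) :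
  invn (lift_perm ord0 j t) = (j + invn t)%N.
Proof.
rewrite /invn big_ord_recl; congr (_ + _)%N.
  rewrite big_ord_recl /= add0n.
  under eq_bigr => y _ do rewrite lift_perm_lift lift_perm_id /= /bump.
  rewrite (reindex_inj (@perm_inj _ t^-1)) /=.
  under eq_bigr => y _ do rewrite permKV.
  under eq_bigr => y _ do rewrite -/(bump j y) bump_ltn_self.
  by rewrite sum_ltn_ord; have := ltn_ord j; lia.
apply: eq_bigr => x _; rewrite big_ord_recl /= add0n.
by apply: eq_bigr => y _; rewrite !lift_perm_lift /= !bump_ltn.
Qed.

Lemma odd_perm_invn n (s : 'S_n) : odd_perm s = odd (invn s).
Proof.
elim: n s => [|n IH] s; first by rewrite permS0 odd_perm1 /invn big_ord0.
by rewrite -(lift_unlift_perm ord0 s) odd_lift_perm invn_lift0 oddD IH.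
Qed.

Section RestrRank.

Variables (k : nat) (tau : 'S_k) (M : {set 'I_k}).

Lemma enum_val_ltn (g h : 'I_#|M|) : (enum_val g < enum_val h)%N = (g < h)%N.
Proof.
have sortedM : sorted (fun x y : 'I_k => (x < y)%N) (enum M).
  have -> : enum M = filter (mem M) (enum 'I_k) by rewrite enumT.
  apply: sorted_filter; first by move=> ? ? ?; exact: ltn_trans.
  by have := iota_ltn_sorted 0 k; rewrite -val_enum_ord sorted_map.
have mono (g' h' : 'I_#|M|) : (g' < h')%N -> (enum_val g' < enum_val h')%N.
  move=> lt; have x0 := enum_val g'; rewrite !(enum_val_nth x0).
  apply: (sorted_ltn_nth _ _ sortedM) => //;
    [by move=> ? ? ?; apply: ltn_trans | by rewrite inE -cardE..].
case: (ltngtP g h) => [/mono // | /mono /ltnW | /val_inj -> ]; last by rewrite ltnn.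
by rewrite leqNgt => /negbTE.
Qed.

Let rank (g : 'I_#|M|) :=
  #|[set h : 'I_#|M| | (tau (enum_val h) <= tau (enum_val g))%N]|.
Let rank_fun (g : 'I_#|M|) := insubd g (rank g).-1.

Lemma rank_funE g : val (rank_fun g) = (rank g).-1.
Proof.
have rank_gt0 : (0 < rank g)%N by apply/card_gt0P; exists g; rewrite inE.
have rank_le : (rank g <= #|M|)%N by rewrite -[leqRHS]card_ord max_card.
by rewrite val_insubd; case: ifP => //; lia.
Qed.

Lemma rank_fun_ltn g h :
  (rank_fun g < rank_fun h)%N = (tau (enum_val g) < tau (enum_val h))%N.
Proof.
have rank_gt0 g' : (0 < rank g')%N by apply/card_gt0P; exists g'; rewrite inE.
rewrite !rank_funE; case: (ltnP (tau (enum_val g)) (tau (enum_val h))) => lt_gh.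
  suff : (rank g < rank h)%N by have := rank_gt0 g; lia.
  apply: proper_card; apply/properP; split.
    by apply/subsetP => x; rewrite !inE => /leq_trans; apply; apply: ltnW.
  by exists h; rewrite !inE // -ltnNge.
suff : (rank h <= rank g)%N by have := rank_gt0 h; lia.
by apply/subset_leq_card/subsetP => x; rewrite !inE => /leq_trans; apply.
Qed.

Lemma restr_rank_ltn g h :
  (restr_rank tau M g < restr_rank tau M h)%N = (tau (enum_val g) < tau (enum_val h))%N.
Proof.
have rank_fun_inj : injective rank_fun.
  move=> g' h' eq_gh; apply/enum_val_inj/(@perm_inj _ tau)/val_inj/eqP.
  have := rank_fun_ltn g' h'; have := rank_fun_ltn h' g'; rewrite eq_gh ltnn.
  by case: ltngtP.
have -> : restr_rank tau M = perm_of_fun rank_fun by [].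
rewrite /perm_of_fun; case: injectiveP => [? | //].
by rewrite !permE rank_fun_ltn.
Qed.

End RestrRank.

Lemma invn_restr_rank k (tau : 'S_k) (M : {set 'I_k}) : invn (restr_rank tau M) =
  (\sum_(x in M) \sum_(y in M) ((x < y) && (tau y < tau x)))%N.
Proof.
rewrite /invn [RHS]big_enum_val; apply: eq_bigr => g _; rewrite [RHS]big_enum_val.
by apply: eq_bigr => h _; rewrite !restr_rank_ltn enum_val_ltn.
Qed.

Definition invn_out k (B : {set 'I_k}) (s : 'S_k) : nat :=
  \sum_(x < k) \sum_(y < k) [&& x < y, s y < s x & ~~ ((x \in B) && (y \in B))]%N.

Lemma sgnp_restr_rank k (s : 'S_k) (B : {set 'I_k}) :
  sgnp s * sgnp (restr_rank s^-1 B) = (-1) ^+ invn_out B s^-1.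
Proof.
set tau := (s^-1)%g.
have split_invn : invn tau = (invn_out B tau + invn (restr_rank tau B))%N.
  rewrite invn_restr_rank /invn /invn_out [X in (_ + X)%N]big_mkcond -big_split /=.
  apply: eq_bigr => x _; case: (x \in B); last first.
    by rewrite addn0; apply: eq_bigr => y _; rewrite /= andbT.
  rewrite [X in (_ + X)%N]big_mkcond -big_split /=; apply: eq_bigr => y _.
  by case: (y \in B); case: (x < y)%N; case: (tau y < tau x)%N.
rewrite /sgnp -(odd_permV s) -/tau !odd_perm_invn split_invn !signr_odd -exprD.
by rewrite -addnA addnn exprD -[(-1) ^+ _.*2]signr_odd odd_double mulr1.
Qed.

Section FirstEdge.

Variables (V : finType) (k : nat).

(* [Ptrail] holds vacuously when there are no edges; the empty trail must start at the
   target. *)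
Definition euler_trail (G : drgraph V k) (s : 'S_k) : bool :=
  Ptrail G s && ((k == 0%N) ==> (sroot G == troot G)).

Definition graph_after (G : drgraph V k.+1) (j : 'I_k.+1) : drgraph V k :=
  DRGraph (fun x => src G (lift j x)) (fun x => tgt G (lift j x)) (tgt G j) (troot G).

Lemma forall_ord0 (P : pred 'I_k.+1) :
  [forall p : 'I_k.+1, (val p == 0%N) ==> P p] = P ord0.
Proof.
apply/forallP/idP => [/(_ ord0) /implyP -> // | P0 p].
by apply/implyP => /eqP p0; have -> : p = ord0 by apply: val_inj.
Qed.

Lemma forall_ord_max (P : pred 'I_k.+1) :
  [forall p : 'I_k.+1, (val p == k) ==> P p] = P ord_max.
Proof.
apply/forallP/idP => [/(_ ord_max) /implyP -> // | Pmax p].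
by apply/implyP => /eqP pk; have -> : p = ord_max by apply: val_inj.
Qed.

End FirstEdge.

Lemma forall_succ_lift0 n (R : 'I_n.+2 -> 'I_n.+2 -> bool) :
  [forall p : 'I_n.+2, forall q : 'I_n.+2, (val q == (val p).+1) ==> R p q] =
  R ord0 (lift ord0 ord0) &&
  [forall p : 'I_n.+1, forall q : 'I_n.+1,
     (val q == (val p).+1) ==> R (lift ord0 p) (lift ord0 q)].
Proof.
apply/idP/andP => [allR | [R0 allR]].
  split; first by move/forallP/(_ ord0)/forallP/(_ (lift ord0 ord0))/implyP: allR; apply.
  apply/forallP => p; apply/forallP => q; apply/implyP => pq.
  by move/forallP/(_ (lift ord0 p))/forallP/(_ (lift ord0 q))/implyP: allR; apply.
apply/forallP => p; apply/forallP => q; apply/implyP => /eqP pq.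
case: (unliftP ord0 p) => [p'|] -> in pq *; last first.
  by have -> : q = lift ord0 ord0 by apply: val_inj; rewrite /= pq.
case: (unliftP ord0 q) => [q'|] -> in pq *; last by [].
by move/forallP/(_ p')/forallP/(_ q')/implyP: allR; apply; rewrite /= /bump in pq *; lia.
Qed.

Lemma Ptrail_lift0 (V : finType) k (G : drgraph V k.+1) j (t : 'S_k) :
  Ptrail G (lift_perm ord0 j t) =
  (src G j == sroot G) && euler_trail (graph_after G j) t.
Proof.
rewrite /euler_trail /Ptrail forall_ord0 forall_ord_max lift_perm_id.
case: k G j t => [|k] G j t.
  have forall0 (P : pred 'I_0) : [forall p, P p] by apply/forallP => [[]].
  have -> : [forall p : 'I_1, forall q : 'I_1, (val q == (val p).+1) ==>
      (src G (lift_perm ord0 j t q) == tgt G (lift_perm ord0 j t p))].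
    by apply/forallP => p; apply/forallP => q; rewrite !ord1.
  rewrite !forall0 (_ : ord_max = ord0) ?lift_perm_id /= ?andbT //; exact: val_inj.
rewrite forall_succ_lift0 forall_ord0 forall_ord_max /= andbT.
rewrite (_ : ord_max = lift ord0 ord_max); last exact: val_inj.
rewrite !lift_perm_lift lift_perm_id.
under eq_forallb => p do under eq_forallb => q do rewrite !lift_perm_lift.
by case: (src G j == sroot G); case: (src G _ == tgt G j); case: (tgt G _ == troot G).
Qed.

Lemma invn_out_lift0 k (B : {set 'I_k.+1}) (j : 'I_k.+1) (r : 'S_k) :
  invn_out B (lift_perm j ord0 r) =
  (\sum_(x < k.+1) ((x < j) && ~~ ((x \in B) && (j \in B))) +
   invn_out (lift j @^-1: B) r)%N.
Proof.
rewrite /invn_out exchange_big (bigD1_ord j) //=; congr (_ + _)%N.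
  apply: eq_bigr => x _; rewrite lift_perm_id.
  case: (ltnP x j) => //= ltxj.
  case: (unliftP j x) => [x'|] def_x; last by move: ltxj; rewrite def_x ltnn.
  by rewrite def_x lift_perm_lift.
rewrite [RHS]exchange_big; apply: eq_bigr => y _.
rewrite (bigD1_ord j) //= lift_perm_id ltn0 andbF add0n.
by apply: eq_bigr => x _; rewrite !lift_perm_lift /= !bump_ltn !inE.
Qed.

Lemma euler_trailS (V : finType) k (G : drgraph V k.+1) s :
  euler_trail G s = Ptrail G s.
Proof. by rewrite /euler_trail andbT. Qed.

Definition euler_sum (V : finType) k (G : drgraph V k) (B : {set 'I_k}) : int :=
  \sum_(s : 'S_k | euler_trail G s) (-1) ^+ invn_out B s^-1.

Lemma Ssum_euler_sum (V : finType) k (G : drgraph V k) B :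
  (0 < k)%N -> Ssum G B = euler_sum G B.
Proof.
case: k G B => // k G B _; apply: eq_big => [s | s _]; first by rewrite euler_trailS.
exact: sgnp_restr_rank.
Qed.

Lemma euler_sum_first_edge (V : finType) k (G : drgraph V k.+1) B :
  euler_sum G B = \sum_(j < k.+1 | src G j == sroot G)
     (-1) ^+ (\sum_(x < k.+1) ((x < j) && ~~ ((x \in B) && (j \in B))))%N *
     euler_sum (graph_after G j) (lift j @^-1: B).
Proof.
rewrite /euler_sum (partition_big (fun s : 'S_k.+1 => s ord0) xpredT) //=.
rewrite [RHS]big_mkcond; apply: eq_bigr => j _.
rewrite big_mkcondl sum_lift_perm.
under [in LHS]eq_bigr => t _ do
  rewrite euler_trailS Ptrail_lift0 lift_permV invn_out_lift0.
case: (src G j == sroot G) => /=; last by rewrite big1.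
by rewrite mulr_sumr -big_mkcond; apply: eq_bigr => t _; rewrite exprD.
Qed.

Section RemNth.

Variable T : Type.

Definition rem_nth (i : nat) (s : seq T) := take i s ++ drop i.+1 s.

Lemma size_rem_nth (s : seq T) i :
  (i < size s)%N -> size (rem_nth i s) = (size s).-1.
Proof. by move=> lt_is; rewrite /rem_nth size_cat size_take size_drop lt_is; lia. Qed.

Lemma rem_nth_cat_l (s1 s2 : seq T) i :
  (i < size s1)%N -> rem_nth i (s1 ++ s2) = rem_nth i s1 ++ s2.
Proof.
move=> lt_is1; rewrite /rem_nth take_cat drop_cat lt_is1 -catA; congr (_ ++ _).
by case: ltnP => // le_s1i; rewrite (_ : _ - _ = 0)%N ?drop0 ?drop_oversize //; lia.
Qed.

Lemma rem_nth_cat_r (s1 s2 : seq T) j :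
  rem_nth (size s1 + j) (s1 ++ s2) = s1 ++ rem_nth j s2.
Proof.
rewrite /rem_nth take_cat drop_cat ltnNge leq_addr /= addKn catA.
by rewrite ltnNge (_ : size s1 <= _)%N /= -?addnS ?addKn //; lia.
Qed.

Lemma count_rem_nth (p : pred T) s i x0 : (i < size s)%N ->
  count p s = (count p (rem_nth i s) + p (nth x0 s i))%N.
Proof.
move=> lt_is; rewrite -{1}(cat_take_drop i s) (drop_nth x0 lt_is) /rem_nth.
by rewrite !count_cat /=; lia.
Qed.

End RemNth.

Lemma map_rem_nth (T U : Type) (f : T -> U) s i :
  map f (rem_nth i s) = rem_nth i (map f s).
Proof. by rewrite /rem_nth map_cat map_take map_drop. Qed.

Lemma all_rem_nth (T : eqType) (p : pred T) s i : all p s -> all p (rem_nth i s).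
Proof.
by move/allP => ps; apply/allP => x /[!mem_cat] /orP[/mem_take | /mem_drop]; apply: ps.
Qed.

Lemma rem_nth_map_enum (T : Type) n (f : 'I_n.+1 -> T) (j : 'I_n.+1) :
  rem_nth j [seq f x | x <- enum 'I_n.+1] = [seq f (lift j x) | x <- enum 'I_n].
Proof.
have lt_jn := ltn_ord j.
have size_lhs : size (rem_nth j [seq f x | x <- enum 'I_n.+1]) = n.
  by rewrite size_rem_nth size_map size_enum_ord.
apply: (@eq_from_nth _ (f j)); first by rewrite size_lhs size_map size_enum_ord.
move=> i; rewrite size_lhs => lt_in.
rewrite (nth_map (Ordinal lt_in)) ?size_enum_ord // nth_cat size_take size_map.
rewrite size_enum_ord lt_jn; case: ltnP => [lt_ij | le_ji].
  rewrite nth_take // (nth_map j); last by rewrite size_enum_ord; lia.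
  by congr f; apply: val_inj; rewrite /= !nth_enum_ord //= /bump; lia.
rewrite nth_drop (nth_map j); last by rewrite size_enum_ord; lia.
by congr f; apply: val_inj; rewrite /= !nth_enum_ord //= /bump; lia.
Qed.

Section ListTrailSum.

Variables (V : eqType) (t : V).

(* Each edge carries the flag of membership in B; the fuel [N] is [size L] in all uses. *)
Fixpoint trail_sum (N : nat) (v : V) (L : seq ((V * V) * bool)) : int :=
  if N is N'.+1 then
    \sum_(i < size L)
      let e := nth (v, v, false) L i in
      if e.1.1 == v then
        (-1) ^+ (\sum_(0 <= x < i) ~~ ((nth (v, v, false) L x).2 && e.2))%N *
        trail_sum N' e.1.2 (rem_nth i L)
      else 0
  else (v == t)%:R.

End ListTrailSum.

Definition edge_list (V : finType) k (G : drgraph V k) (B : {set 'I_k}) :=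
  [seq (src G x, tgt G x, x \in B) | x <- enum 'I_k].

Lemma euler_sum_trail_sum (V : finType) k (G : drgraph V k) B :
  euler_sum G B = trail_sum (troot G) k (sroot G) (edge_list G B).
Proof.
elim: k G B => [|k IH] G B.
  have trail0 s : euler_trail G s = (sroot G == troot G).
    rewrite /euler_trail /Ptrail.
    by do 3 rewrite (_ : [forall _, _]) //; apply/forallP => [[]].
  rewrite /euler_sum /= (eq_bigl _ _ trail0).
  case: eqP => _ /=; last by rewrite big_pred0.
  rewrite (big_pred1 1%g) => [|s]; last by rewrite (permS0 s) /= eqxx.
  by rewrite /invn_out big_ord0.
rewrite euler_sum_first_edge /= /edge_list size_map size_enum_ord big_mkcond /=.
apply: eq_bigr => j _.
set L := [seq _ | x <- enum 'I_k.+1].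
have nthL (x : 'I_k.+1) :
    nth (sroot G, sroot G, false) L x = (src G x, tgt G x, x \in B).
  by rewrite /L (nth_map x) ?size_enum_ord // nth_ord_enum.
rewrite nthL /=; case: ifP => // _; congr (_ ^+ _ * _).
  rewrite (big_nat_widen 0 j k.+1) 1?ltnW // big_mkord [RHS]big_mkcond /=.
  by apply: eq_bigr => x _; rewrite nthL; case: (x < j)%N.
rewrite IH /L rem_nth_map_enum; congr trail_sum; apply: eq_map => x.
by rewrite inE.
Qed.

Definition plain_edge {V : Type} (e : V * V) : (V * V) * bool := (e, false).

Section UpDownEdges.

Variables (V : eqType) (s t : V).

Definition up_edge : (V * V) * bool := ((s, t), true).
Definition down_edge : (V * V) * bool := ((t, s), true).

(* [updown_sum v a b S] is [trail_sum] on [a] copies of [up_edge] and [b] copies of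
   [down_edge], followed by the unflagged edges [S] (lemma [trail_sum_up_down]). *)
Fixpoint updown_sum_fuel (N : nat) (v : V) (a b : nat) (S : seq (V * V)) : int :=
  if N is N'.+1 then
    (if v == s then a%:R * updown_sum_fuel N' t a.-1 b S else 0) +
    (if v == t then b%:R * updown_sum_fuel N' s a b.-1 S else 0) +
    \sum_(i < size S)
      let e := nth (v, v) S i in
      if e.1 == v then (-1) ^+ (a + b + i) * updown_sum_fuel N' e.2 a b (rem_nth i S)
      else 0
  else (v == t)%:R.

Definition updown_sum v a b S := updown_sum_fuel (a + b + size S) v a b S.

Lemma updown_sumE v a b S : updown_sum v a b S =
  ((a + b + size S == 0)%N && (v == t))%:R +
  (if v == s then a%:R * updown_sum t a.-1 b S else 0) +
  (if v == t then b%:R * updown_sum s a b.-1 S else 0) +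
  \sum_(i < size S)
     let e := nth (v, v) S i in
     if e.1 == v then (-1) ^+ (a + b + i) * updown_sum e.2 a b (rem_nth i S) else 0.
Proof.
rewrite /updown_sum; case def_N: (a + b + size S)%N => [|N] /=.
  have [-> [-> /size0nil ->]] : (a = 0 /\ b = 0 /\ size S = 0)%N by lia.
  by rewrite big_ord0 !mul0r; case: (v == t); case: (v == s).
rewrite add0r; congr (_ + _ + _).
- case: (v == s) => //; case: a def_N => [|a] def_N; first by rewrite !mul0r.
  by rewrite (_ : a.+1.-1 + b + size S = N)%N //; lia.
- case: (v == t) => //; case: b def_N => [|b] def_N; first by rewrite !mul0r.
  by rewrite (_ : a + b.+1.-1 + size S = N)%N //; lia.
apply: eq_bigr => i _; case: ifP => // _.
by rewrite size_rem_nth // (_ : a + b + (size S).-1 = N)%N //; have := ltn_ord i; lia.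
Qed.

Hypothesis s_neq_t : s != t.

Lemma up_neq_down : (up_edge == down_edge) = false.
Proof. by rewrite /up_edge /down_edge !xpair_eqE (negbTE s_neq_t). Qed.

Lemma sum_up_down (F : (V * V) * bool -> int) P :
  all (mem [:: up_edge; down_edge]) P ->
  \sum_(e <- P) F e = (count_mem up_edge P)%:R * F up_edge +
                      (count_mem down_edge P)%:R * F down_edge.
Proof.
elim: P => [|e P IH]; first by rewrite big_nil !mul0r addr0.
rewrite /= big_cons => /andP[/[!inE] /orP[] /eqP -> /IH ->].
  by rewrite eqxx up_neq_down /= !natrD; ring.
by rewrite eqxx eq_sym up_neq_down /= !natrD; ring.
Qed.

Lemma size_up_down P : all (mem [:: up_edge; down_edge]) P ->
  size P = (count_mem up_edge P + count_mem down_edge P)%N.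
Proof.
elim: P => //= e P IH /andP[/[!inE] /orP[] /eqP -> /IH ->].
  by rewrite eqxx up_neq_down; lia.
by rewrite eqxx eq_sym up_neq_down; lia.
Qed.

Lemma trail_sum_up_down N (P : seq ((V * V) * bool)) S v : (size P + size S)%N = N ->
  all (mem [:: up_edge; down_edge]) P ->
  trail_sum t N v (P ++ map plain_edge S) =
  updown_sum v (count_mem up_edge P) (count_mem down_edge P) S.
Proof.
elim: N => [|N IH] in P S v *.
  by case: P => [|//]; case: S => [|//] _ _; rewrite /updown_sum.
move=> sizePS udP; have sizeP := size_up_down udP.
rewrite updown_sumE -sizeP (_ : (size P + size S == 0)%N = false) ?add0r; last by lia.
rewrite /= size_cat size_map big_split_ord; congr (_ + _).
  pose G (e : (V * V) * bool) := if e.1.1 == v then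
    updown_sum e.1.2 (count_mem up_edge P - (e == up_edge))
                 (count_mem down_edge P - (e == down_edge)) S else 0.
  transitivity (\sum_(e <- P) G e); last first.
    rewrite sum_up_down // /G /= !eqxx [up_edge == down_edge]up_neq_down.
    rewrite [down_edge == up_edge]eq_sym [up_edge == down_edge]up_neq_down.
    rewrite !subn0 !subn1.
    by rewrite (eq_sym s v) (eq_sym t v); case: (v == s); case: (v == t);
      rewrite ?mulr0 ?addr0 ?add0r.
  rewrite (big_nth (v, v, false)) big_mkord; apply: eq_bigr => i _.
  have lt_iP := ltn_ord i; have udPi := allP udP _ (mem_nth (v, v, false) lt_iP).
  rewrite /= nth_cat lt_iP /G; case: ifP => // _.
  rewrite big_nat big1 ?expr0 ?mul1r => [|x /andP[_ lt_xi]]; last first.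
    have lt_xP := ltn_trans lt_xi lt_iP.
    move: (allP udP _ (mem_nth (v, v, false) lt_xP)) udPi; rewrite nth_cat lt_xP.
    by rewrite !inE => /orP[] /eqP -> /orP[] /eqP ->.
  rewrite rem_nth_cat_l // IH ?all_rem_nth //; last first.
    by rewrite size_rem_nth //; have := leq_ltn_trans (leq0n i) lt_iP; lia.
  rewrite (count_rem_nth _ (v, v, false) lt_iP).
  by rewrite (count_rem_nth (pred1 down_edge) (v, v, false) lt_iP) !addnK.
apply: eq_bigr => j _; have lt_jS := ltn_ord j.
rewrite /= nth_cat ltnNge leq_addr /= addKn (nth_map (v, v)) //=; case: ifP => // _.
under eq_bigr do rewrite andbF.
rewrite sum_nat_const_nat muln1 subn0 rem_nth_cat_r -map_rem_nth IH //.
by rewrite size_rem_nth //; lia.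
Qed.

End UpDownEdges.

(* [newton p n] is the sum of the [p`_k * 'C(n, k)]: in this basis prepending a coefficient
   inverts the forward difference. *)
Fixpoint newton (p : seq int) (n : nat) : int :=
  if p is c :: q then c + \sum_(m < n) newton q m else 0.

Fixpoint newton_add (p q : seq int) : seq int :=
  match p, q with
  | [::], _ => q
  | _, [::] => p
  | c :: p', d :: q' => (c + d) :: newton_add p' q'
  end.

Definition newton_scale (z : int) (p : seq int) : seq int := map ( *%R z) p.

Fixpoint newton_shift (p : seq int) : seq int :=
  if p is c :: q then (c + head 0 q) :: newton_shift q else [::].

Lemma newton0 p : newton p 0 = head 0 p.
Proof. by case: p => [|c p] //=; rewrite big_ord0 addr0. Qed.

Lemma newton_consS c p n : newton (c :: p) n.+1 = newton (c :: p) n + newton p n.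
Proof. by rewrite /= big_ord_recr addrA. Qed.

Lemma newtonD p q n : newton (newton_add p q) n = newton p n + newton q n.
Proof.
elim: p q n => [|c p IH] [|d q] n /=; rewrite ?add0r ?addr0 //.
by under eq_bigr do rewrite IH; rewrite big_split addrACA.
Qed.

Lemma newtonZ z p n : newton (newton_scale z p) n = z * newton p n.
Proof.
elim: p n => [|c p IH] n /=; first by rewrite mulr0.
by rewrite mulrDr mulr_sumr; under eq_bigr do rewrite IH.
Qed.

Lemma newton_shiftE p n : newton (newton_shift p) n = newton p n.+1.
Proof.
elim: p n => [|c p IH] n //=.
rewrite big_ord_recl -newton0 addrA; congr (_ + _).
by apply: eq_bigr => i _; rewrite IH.
Qed.

Lemma newton_sum (I : Type) (r : seq I) (f : I -> seq int) n :
  newton (foldr newton_add [::] (map f r)) n = \sum_(i <- r) newton (f i) n.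
Proof. by elim: r => [|i r IH]; rewrite ?big_nil ?big_cons //= newtonD IH. Qed.

Lemma newton_consE c q (f : nat -> int) :
  f 0%N = c -> (forall n, f n.+1 = f n + newton q n) -> newton (c :: q) =1 f.
Proof. by move=> f0 fS; elim=> [|n IH]; rewrite ?newton0 // newton_consS IH fS. Qed.

Section Certificate.

Variables (V : eqType) (s t : V).
Hypothesis s_neq_t : s != t.

(* A trail from [v] to [t] through [S], [a] up-edges and [b] down-edges balances the
   degree at [s] only if [a - b = (v == s) + #(edges of S into s) - #(edges of S out of s)];
   these are the positive and negative parts of that difference. *)
Definition up_excess (v : V) (S : seq (V * V)) : nat :=
  ((v == s) + count (fun e => e.2 == s) S - count (fun e => e.1 == s) S)%N.
Definition down_excess (v : V) (S : seq (V * V)) : nat :=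
  (count (fun e => e.1 == s) S - ((v == s) + count (fun e => e.2 == s) S))%N.

Definition branch_sum S (child : nat -> V -> seq int) (v : V) : seq int :=
  foldr newton_add [::] [seq let e := nth (v, v) S i in
     if e.1 == v then
       newton_scale ((-1) ^+ (up_excess v S + down_excess v S + i)) (child i e.2)
     else [::] | i <- iota 0 (size S)].

(* Solves the recursion of [updown_sumE] in [n], with [br] the branch sums: when [t] needs
   no down-edge, [P_s = P_t + br_s] and [P_t (n+1) = P_s n + br_t (n+1)], the term
   [S == [::]] being the empty trail at [t]; otherwise the same holds with [s] and [t]
   exchanged. *)
Definition trail_poly_step S (br : V -> seq int) (v : V) : seq int :=
  let br_s := br s in let br_t := br t in
  if down_excess t S == 0%N then
    let p_t := (head 0 br_t + (S == [::])%:R) :: newton_add br_s (newton_shift br_t) in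
    if v == s then newton_add p_t br_s else if v == t then p_t else br v
  else
    let p_s := head 0 br_s :: newton_add br_t (newton_shift br_s) in
    if v == s then p_s else if v == t then newton_add p_s br_t else br v.

Fixpoint trail_poly_fuel (N : nat) (S : seq (V * V)) : V -> seq int :=
  trail_poly_step S (branch_sum S (fun i =>
    if N is N'.+1 then trail_poly_fuel N' (rem_nth i S) else fun _ => [::])).

Definition trail_poly S := trail_poly_fuel (size S) S.

Lemma eq_trail_poly_step S br1 br2 :
  br1 =1 br2 -> trail_poly_step S br1 =1 trail_poly_step S br2.
Proof. by move=> eq_br v; rewrite /trail_poly_step !eq_br. Qed.

Lemma eq_in_branch_sum S c1 c2 :
  (forall i, (i < size S)%N -> c1 i =1 c2 i) -> branch_sum S c1 =1 branch_sum S c2.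
Proof.
move=> eq_c v; rewrite /branch_sum; congr foldr; apply/eq_in_map => i.
by rewrite mem_iota => /andP[_ lt_iS]; rewrite eq_c.
Qed.

Lemma trail_polyE S :
  trail_poly S =1 trail_poly_step S (branch_sum S (fun i => trail_poly (rem_nth i S))).
Proof.
case: S => [|e S] //; apply/eq_trail_poly_step/eq_in_branch_sum => i lt_iS v.
by rewrite /trail_poly size_rem_nth.
Qed.

Let branches S := branch_sum S (fun i => trail_poly (rem_nth i S)).

Lemma trail_poly_other S v : v != s -> v != t -> trail_poly S v = branches S v.
Proof.
move=> /negbTE vs /negbTE vt; rewrite trail_polyE /trail_poly_step vs vt.
by case: (down_excess t S == 0%N).
Qed.

Lemma trail_poly_balanced S n : down_excess t S = 0%N ->
  [/\ newton (trail_poly S s) n = newton (trail_poly S t) n + newton (branches S s) n,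
      newton (trail_poly S t) n.+1 =
        newton (trail_poly S s) n + newton (branches S t) n.+1
    & newton (trail_poly S t) 0 = newton (branches S t) 0 + (S == [::])%:R].
Proof.
have /negbTE ts := s_neq_t; rewrite eq_sym in ts.
move=> dt0; have poly_s : trail_poly S s = newton_add (trail_poly S t) (branches S s).
  by rewrite !trail_polyE /trail_poly_step dt0 !eqxx ts.
have poly_t : trail_poly S t = (head 0 (branches S t) + (S == [::])%:R) ::
                        newton_add (branches S s) (newton_shift (branches S t)).
  by rewrite trail_polyE /trail_poly_step dt0 !eqxx ts.
rewrite poly_s newtonD; split=> //.
  by rewrite {1}poly_t newton_consS -poly_t newtonD newton_shiftE addrA.
by rewrite poly_t newton0 newton0.
Qed.

Lemma trail_poly_deficit S n : down_excess t S != 0%N ->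
  [/\ newton (trail_poly S t) n = newton (trail_poly S s) n + newton (branches S t) n,
      newton (trail_poly S s) n.+1 =
        newton (trail_poly S t) n + newton (branches S s) n.+1
    & newton (trail_poly S s) 0 = newton (branches S s) 0].
Proof.
have /negbTE ts := s_neq_t; rewrite eq_sym in ts.
move=> /negbTE dt0.
have poly_t : trail_poly S t = newton_add (trail_poly S s) (branches S t).
  by rewrite !trail_polyE /trail_poly_step dt0 !eqxx ts.
have poly_s : trail_poly S s =
    head 0 (branches S s) :: newton_add (branches S t) (newton_shift (branches S s)).
  by rewrite trail_polyE /trail_poly_step dt0 !eqxx.
rewrite poly_t newtonD; split=> //.
  by rewrite {1}poly_s newton_consS -poly_s newtonD newton_shiftE addrA.
by rewrite poly_s !newton0.
Qed.

Lemma excess_balanced S : down_excess t S = 0%N ->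
  up_excess s S = (up_excess t S).+1 /\ down_excess s S = 0%N.
Proof.
by rewrite /up_excess /down_excess eqxx (eq_sym t s) (negbTE s_neq_t) /=; lia.
Qed.

Lemma excess_deficit S : down_excess t S != 0%N ->
  [/\ up_excess s S = 0%N, up_excess t S = 0%N
    & down_excess t S = (down_excess s S).+1].
Proof.
rewrite /up_excess /down_excess eqxx (eq_sym t s) (negbTE s_neq_t) /=.
by move=> /eqP ?; split; lia.
Qed.

Lemma excess_rem_nth v S i : (i < size S)%N -> (nth (v, v) S i).1 = v ->
  up_excess (nth (v, v) S i).2 (rem_nth i S) = up_excess v S /\
  down_excess (nth (v, v) S i).2 (rem_nth i S) = down_excess v S.
Proof.
move=> lt_iS src_i; rewrite /up_excess /down_excess.
rewrite (count_rem_nth (fun e : V * V => e.2 == s) (v, v) lt_iS).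
by rewrite (count_rem_nth (fun e : V * V => e.1 == s) (v, v) lt_iS) /= src_i; lia.
Qed.

Let poly_spec n v S := updown_sum s t v (n + up_excess v S) (n + down_excess v S) S =
  ((n + up_excess v S)`! * (n + down_excess v S)`!)%:R * newton (trail_poly S v) n.

Lemma updown_sum_branches n v S :
  (forall i, (i < size S)%N -> (nth (v, v) S i).1 = v ->
     poly_spec n (nth (v, v) S i).2 (rem_nth i S)) ->
  \sum_(i < size S)
     (let e := nth (v, v) S i in
      if e.1 == v then
        (-1) ^+ (n + up_excess v S + (n + down_excess v S) + i) *
        updown_sum s t e.2 (n + up_excess v S) (n + down_excess v S) (rem_nth i S)
      else 0) =
  ((n + up_excess v S)`! * (n + down_excess v S)`!)%:R * newton (branches S v) n.
Proof.
move=> IH; rewrite /branches /branch_sum newton_sum mulr_sumr.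
have -> : iota 0 (size S) = index_iota 0 (size S) by rewrite /index_iota subn0.
rewrite big_mkord; apply: eq_bigr => i _ /=.
have lt_iS := ltn_ord i.
case: eqP => [src_i | _]; last by rewrite mulr0.
have [up_i down_i] := excess_rem_nth lt_iS src_i.
have := IH i lt_iS src_i; rewrite /poly_spec up_i down_i => ->; rewrite newtonZ mulrCA.
rewrite (_ : n + _ + _ + i = up_excess v S + down_excess v S + i + n.*2)%N; last first.
  by rewrite -addnn; lia.
by rewrite -signr_odd oddD odd_double addbF signr_odd.
Qed.

Let measure n v S := (n + up_excess v S + (n + down_excess v S) + size S)%N.
Let spec_below n v S :=
  forall m w S', (measure m w S' < measure n v S)%N -> poly_spec m w S'.

Lemma spec_children n v S : spec_below n v S ->
  forall i, (i < size S)%N -> (nth (v, v) S i).1 = v ->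
    poly_spec n (nth (v, v) S i).2 (rem_nth i S).
Proof.
move=> IH i lt_iS src_i; apply: IH; rewrite /measure size_rem_nth //.
by have [-> ->] := excess_rem_nth lt_iS src_i; lia.
Qed.

Lemma spec_source n S : spec_below n s S -> poly_spec n s S.
Proof.
move=> IH; rewrite /poly_spec updown_sumE (updown_sum_branches (spec_children IH)).
rewrite eqxx (negbTE s_neq_t) andbF add0r addr0.
have [dt0 | dt] := eqVneq (down_excess t S) 0%N.
  have [-> ->] := excess_balanced dt0.
  have [-> _ _] := trail_poly_balanced n dt0.
  have := IH n t S; rewrite /poly_spec dt0 addnS => -> /=; last first.
    by rewrite /measure; have [-> ->] := excess_balanced dt0; lia.
  by rewrite mulrA -natrM mulnA -factS mulrDr.
have [-> ut dts] := excess_deficit dt.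
case: n IH => [|m] IH.
  by have [_ _ ->] := trail_poly_deficit 0 dt; rewrite !mul0r add0r.
have [_ -> _] := trail_poly_deficit m dt.
rewrite !addSn /=.
have := IH m t S; rewrite /poly_spec ut dts addn0 addnS => ->; last first.
  by rewrite /measure; have [-> -> ->] := excess_deficit dt; lia.
by rewrite mulrDr mulrA -natrM mulnA -factS.
Qed.

Lemma spec_target n S : spec_below n t S -> poly_spec n t S.
Proof.
have /negbTE ts := s_neq_t; rewrite eq_sym in ts.
move=> IH; rewrite /poly_spec updown_sumE (updown_sum_branches (spec_children IH)).
rewrite ts eqxx andbT addr0.
have [dt0 | dt] := eqVneq (down_excess t S) 0%N.
  have [us ds] := excess_balanced dt0; rewrite dt0.
  case: n IH => [|m] IH.
    have [_ _ ->] := trail_poly_balanced 0 dt0.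
    rewrite !mul0r addr0 mulrDr addrC.
    congr (_ + _); case: S {IH dt0 us ds} => [|e S]; first by rewrite /up_excess /= ts.
    by rewrite addnS mulr0.
  have [_ -> _] := trail_poly_balanced m dt0.
  rewrite !addSn /= add0r.
  have := IH m s S; rewrite /poly_spec us ds addnS addn0 => ->; last first.
    by rewrite /measure us ds dt0; lia.
  by rewrite mulrDr mulrA -natrM mulnCA -factS.
have [us ut dts] := excess_deficit dt; have [-> _ _] := trail_poly_deficit n dt.
rewrite (_ : (_ == 0)%N = false) ?add0r; last by rewrite dts ut; lia.
rewrite ut dts addnS /=.
have := IH n s S; rewrite /poly_spec us => ->; last by rewrite /measure us ut dts; lia.
by rewrite mulrDr mulrA -natrM mulnCA -factS.
Qed.

Lemma spec_other n v S : v != s -> v != t -> spec_below n v S -> poly_spec n v S.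
Proof.
move=> /negbTE vs /negbTE vt IH.
rewrite /poly_spec updown_sumE (updown_sum_branches (spec_children IH)).
by rewrite vs vt andbF /= !add0r trail_poly_other ?vs ?vt.
Qed.

Lemma updown_sum_trail_poly n v S :
  updown_sum s t v (n + up_excess v S) (n + down_excess v S) S =
  ((n + up_excess v S)`! * (n + down_excess v S)`!)%:R * newton (trail_poly S v) n.
Proof.
have [K] := ubnP (measure n v S); elim: K => // K IHK in n v S *; rewrite ltnS => leK.
have : spec_below n v S by move=> m w S' lt_m; apply: IHK; apply: leq_trans leK.
case: (eqVneq v s) => [-> | vs]; first exact: spec_source.
case: (eqVneq v t) => [-> | vt]; first exact: spec_target.
exact: spec_other.
Qed.

End Certificate.

Definition G3_special : seq ('I_3 * 'I_3) :=
  [:: (V1, V1); (V1, V2); (V2, V3); (V3, V1); (V1, V3); (V3, V2); (V3, V3)].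

Definition G3_updown (mb : nat) : seq (('I_3 * 'I_3) * bool) :=
  [seq if odd i then down_edge V1 V2 else up_edge V1 V2 | i <- iota 0 (2 * mb)].

Lemma V1_neq_V2 : V1 != V2.
Proof. by rewrite -val_eqE /= !inordK. Qed.

Lemma edge_list_G3 mb :
  edge_list (G3 mb) (B3 mb) = G3_updown mb ++ map plain_edge G3_special.
Proof.
pose g n := if (n < 2 * mb)%N then (if odd n then down_edge V1 V2 else up_edge V1 V2)
            else plain_edge (nth (V1, V1) G3_special (n - 2 * mb)).
have -> : G3_updown mb ++ map plain_edge G3_special = map g (iota 0 (2 * mb + 7)).
  rewrite iotaD map_cat; congr (_ ++ _).
    by apply/eq_in_map => n; rewrite mem_iota /g => /andP[_ ->].
  rewrite add0n -[X in iota X 7]addn0 iotaDl -map_comp.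
  have -> : map plain_edge G3_special =
            [seq plain_edge (nth (V1, V1) G3_special j) | j <- iota 0 7] by [].
  by apply: eq_map => j; rewrite /= /g ltnNge leq_addr addKn.
rewrite /edge_list -val_enum_ord -map_comp; apply: eq_map => x /=.
rewrite /G3_src /G3_tgt /g inE; case: ltnP => [_ | ge_x]; first by case: (odd x).
have lt_x := ltn_ord x.
by case: (x - 2 * mb)%N (subnK ge_x) => [|[|[|[|[|[|[|k]]]]]]] //= def_x; lia.
Qed.

Lemma G3_updown_counts mb :
  [/\ all (mem [:: up_edge V1 V2; down_edge V1 V2]) (G3_updown mb),
  count_mem (up_edge V1 V2) (G3_updown mb) = mb &
  count_mem (down_edge V1 V2) (G3_updown mb) = mb].
Proof.
have ud := up_neq_down V1_neq_V2; have du : (down_edge V1 V2 == up_edge V1 V2) = false.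
  by rewrite eq_sym.
elim: mb => [|mb [IH1 IH2 IH3]] //.
rewrite /G3_updown (_ : 2 * mb.+1 = 2 * mb + 2)%N; last by lia.
rewrite iotaD map_cat -/(G3_updown mb) all_cat !count_cat IH1 IH2 IH3 /= add0n.
rewrite oddM /= !eqxx ud du /= !inE !eqxx !orbT; split=> //; lia.
Qed.

(* [vm_compute] does not reduce [inord]. *)
Lemma V123E : [/\ V1 = @Ordinal 3 0 isT, V2 = @Ordinal 3 1 isT & V3 = @Ordinal 3 2 isT].
Proof. by split; apply: val_inj; rewrite /= inordK. Qed.

Lemma trail_poly_G3_special : trail_poly V1 V2 G3_special V1 = [:: 0; 4; 8; 4; 0].
Proof. by rewrite /G3_special; case: V123E => -> -> ->; vm_compute. Qed.

Lemma excess_G3_special :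
  up_excess V1 V1 G3_special = 0%N /\ down_excess V1 V1 G3_special = 0%N.
Proof. by rewrite /G3_special; case: V123E => -> -> ->; vm_compute. Qed.

Lemma Ssum_G3 mb :
  Ssum (G3 mb) (B3 mb) = (mb`! * mb`!)%:R * newton [:: 0; 4; 8; 4; 0] mb.
Proof.
have [updown count_up count_down] := G3_updown_counts mb.
rewrite Ssum_euler_sum ?addn_gt0 ?orbT // euler_sum_trail_sum edge_list_G3.
rewrite (trail_sum_up_down V1_neq_V2) ?count_up ?count_down //; last first.
  by rewrite size_map size_iota.
have [up0 down0] := excess_G3_special.
have := updown_sum_trail_poly V1_neq_V2 mb V1 G3_special.
by rewrite up0 down0 !addn0 trail_poly_G3_special.
Qed.

Lemma newton_G3_closed_form n :
  3 * newton [:: 0; 4; 8; 4; 0] n = 2 * n%:R * (n%:R + 1) * (n%:R + 2).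
Proof.
have e12 : newton [:: 12; 0] =1 fun=> 12.
  by apply: newton_consE => // m; rewrite /= big1 ?addr0.
have e24 : newton [:: 24; 12; 0] =1 fun m => 24 + 12 * m%:R.
  apply: newton_consE => [|m]; first by rewrite mulr0 addr0.
  by rewrite e12 -[m.+1%:R]natr1; ring.
have e6 : newton [:: 12; 24; 12; 0] =1 fun m => 6 * (m%:R + 1) * (m%:R + 2).
  apply: newton_consE => [|m]; first by rewrite add0r mulr1; ring.
  by rewrite e24 -[m.+1%:R]natr1; ring.
rewrite -newtonZ (_ : newton_scale 3 _ = [:: 0; 12; 24; 12; 0]) //; move: n.
apply: newton_consE => [|m]; first by rewrite mulr0 !mul0r.
by rewrite e6 -[m.+1%:R]natr1; ring.
Qed.

Theorem lemma3p6 (mb : nat) (hmb : (1 <= mb)%N) :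
  (Ssum (G3 mb) (B3 mb))%:~R =
    (2%:R / 3%:R : rat) * mb%:R * (mb.+2)`!%:R * (mb`!)%:R.
Proof.
rewrite Ssum_G3; move: (newton_G3_closed_form mb).
move: (newton _ mb) => x /(congr1 (intmul (1 : rat))).
rewrite !intrM !intrD !rmorph_nat => x3.
rewrite (_ : x%:~R = 2 * mb%:R * (mb%:R + 1) * (mb%:R + 2) / 3); last first.
  by rewrite -x3 mulrC mulKf.
by rewrite !factS !natrM -[mb.+2%:R]natr1 -[mb.+1%:R]natr1; field.
Qed.
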